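(* Let $f:\mathcal{E}'\to\mathcal{E}$ be a geometric morphism of toposes, with inverse image $f^*:\mathcal{E}\to\mathcal{E}'$ and direct image $f_*:\mathcal{E}'\to\mathcal{E}$. If the unit $\eta:\mathrm{id}_{\mathcal{E}}\Rightarrow f_*f^*$ is pointwise mono (every component $\eta_x$ is a monomorphism), then $\eta$ is elementary.
   Context: A natural transformation $\alpha:F\Rightarrow G$ between finite-limit-preserving functors (between categories with finite limits) is elementary if its naturality squares at monomorphisms are pullbacks. *)

(* Defs.v *)
From Stdlib Require Import List FinFun.

Set Implicit Arguments.
Unset Strict Implicit.
Unset Printing Implicit Defensive.

Declare Scope cat_scope.
Delimit Scope cat_scope with cat.
Open Scope cat_scope.

Record Category : Type := {
  Ob :> Type;
  Hom : Ob -> Ob -> Type;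
  idm : forall x, Hom x x;
  comp : forall x y z, Hom y z -> Hom x y -> Hom x z;
  comp_idl : forall x y (f : Hom x y), comp (idm y) f = f;
  comp_idr : forall x y (f : Hom x y), comp f (idm x) = f;
  comp_assoc : forall x y z w (h : Hom z w) (g : Hom y z) (f : Hom x y),
    comp h (comp g f) = comp (comp h g) f
}.

Arguments Hom {c} _ _.
Arguments idm {c} x.
Arguments comp {c x y z} _ _.

Notation "g ∘ f" := (comp g f) (at level 40, left associativity) : cat_scope.

Record Functor (C D : Category) : Type := {
  fobj :> C -> D;
  fmap : forall x y : C, Hom x y -> Hom (fobj x) (fobj y);
  fmap_id : forall x : C, fmap (idm x) = idm (fobj x);
  fmap_comp : forall (x y z : C) (g : Hom y z) (f : Hom x y),
    fmap (g ∘ f) = fmap g ∘ fmap f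
}.

Arguments fmap {C D} _ {x y} _.

Definition idF (C : Category) : Functor C C.
Proof.
refine {| fobj := fun x => x; fmap := fun x y u => u |}; reflexivity.
Defined.

Definition compF (C D E : Category) (G : Functor D E) (F : Functor C D) :
  Functor C E.
Proof.
refine {| fobj := fun x => G (F x); fmap := fun x y u => fmap G (fmap F u) |}.
- intros x; rewrite fmap_id; apply fmap_id.
- intros x y z g f; rewrite fmap_comp; apply fmap_comp.
Defined.

Record NatTrans (C D : Category) (F G : Functor C D) : Type := {
  component :> forall x : C, Hom (F x) (G x);
  naturality : forall (x y : C) (u : Hom x y),
    component y ∘ fmap F u = fmap G u ∘ component x
}.

Definition mono (C : Category) (x y : C) (m : Hom x y) : Prop :=
  forall (w : C) (a b : Hom w x), m ∘ a = m ∘ b -> a = b.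

(* The square with projections p1, p2 over the cospan (f, g):
      p --p2--> y
      |         |
      p1        g
      v         v
      x --f---> z     *)
Definition is_pullback (C : Category) (p x y z : C) (p1 : Hom p x)
    (p2 : Hom p y) (f : Hom x z) (g : Hom y z) : Prop :=
  f ∘ p1 = g ∘ p2 /\
  forall (w : C) (a : Hom w x) (b : Hom w y), f ∘ a = g ∘ b ->
    exists! h : Hom w p, p1 ∘ h = a /\ p2 ∘ h = b.

Definition is_terminal (C : Category) (t : C) : Prop :=
  forall x : C, exists! u : Hom x t, True.

Definition is_product (C : Category) (p x y : C) (p1 : Hom p x)
    (p2 : Hom p y) : Prop :=
  forall (w : C) (a : Hom w x) (b : Hom w y),
    exists! h : Hom w p, p1 ∘ h = a /\ p2 ∘ h = b.

Definition finite_category (J : Category) : Prop :=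
  Finite J /\ forall i j : J, Finite (Hom i j).

Definition is_cone (J C : Category) (D : Functor J C) (x : C)
    (l : forall j : J, Hom x (D j)) : Prop :=
  forall (i j : J) (u : Hom i j), fmap D u ∘ l i = l j.

Definition is_limit (J C : Category) (D : Functor J C) (x : C)
    (l : forall j : J, Hom x (D j)) : Prop :=
  is_cone l /\
  forall (w : C) (c : forall j : J, Hom w (D j)), is_cone c ->
    exists! h : Hom w x, forall j, l j ∘ h = c j.

Arguments is_cone {J C} D {x} l.
Arguments is_limit {J C} D {x} l.

Definition has_finite_limits (C : Category) : Prop :=
  forall (J : Category), finite_category J -> forall D : Functor J C,
    exists (x : C) (l : forall j : J, Hom x (D j)), is_limit D l.

Definition preserves_finite_limits (C D : Category) (F : Functor C D) : Prop :=
  forall (J : Category), finite_category J ->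
    forall (K : Functor J C) (x : C) (l : forall j : J, Hom x (K j)),
      is_limit K l -> is_limit (compF F K) (fun j => fmap F (l j)).

Record FinLimCat : Type := {
  flc_cat :> Category;
  flc_limits : has_finite_limits flc_cat
}.

Record LexFunctor (C D : Category) : Type := {
  lex_fun :> Functor C D;
  lex_preserves : preserves_finite_limits lex_fun
}.

(* ev : e × a -> b, with e × a any product p of e and a: every g : y × a -> b
   is ev ∘ (h × id_a) for a unique h : y -> e. *)
Definition is_exponential (C : Category) (a b e p : C) (p1 : Hom p e)
    (p2 : Hom p a) (ev : Hom p b) : Prop :=
  is_product p1 p2 /\
  forall (y q : C) (q1 : Hom q y) (q2 : Hom q a), is_product q1 q2 ->
    forall g : Hom q b, exists! h : Hom y e,
      exists t : Hom q p, p1 ∘ t = h ∘ q1 /\ p2 ∘ t = q2 /\ ev ∘ t = g.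

Definition has_exponentials (C : Category) : Prop :=
  forall a b : C, exists (e p : C) (p1 : Hom p e) (p2 : Hom p a) (ev : Hom p b),
    is_exponential p1 p2 ev.

Definition is_subobject_classifier (C : Category) (one omega : C)
    (tt : Hom one omega) : Prop :=
  is_terminal one /\
  forall (a b : C) (m : Hom a b), mono m ->
    exists! chi : Hom b omega,
      exists t : Hom a one, is_pullback m t chi tt.

Definition has_subobject_classifier (C : Category) : Prop :=
  exists (one omega : C) (tt : Hom one omega), is_subobject_classifier tt.

(* Elementary toposes; finite limits (in particular finite products) are part
   of FinLimCat. *)
Record Topos : Type := {
  topos_cat :> FinLimCat;
  topos_exponentials : has_exponentials topos_cat;
  topos_classifier : has_subobject_classifier topos_cat
}.

Record Adjunction (C D : Category) (L : Functor C D) (R : Functor D C) : Type := {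
  adj_unit : NatTrans (idF C) (compF R L);
  adj_counit : NatTrans (compF L R) (idF D);
  adj_triangle_l : forall x : C,
    adj_counit (L x) ∘ fmap L (adj_unit x) = idm (L x);
  adj_triangle_r : forall y : D,
    fmap R (adj_counit y) ∘ adj_unit (R y) = idm (R y)
}.

Lemma idF_preserves (C : Category) : preserves_finite_limits (idF C).
Proof. intros J _ K x l Hl; exact Hl. Qed.

Lemma compF_preserves (C D E : Category) (G : Functor D E) (F : Functor C D) :
  preserves_finite_limits G -> preserves_finite_limits F ->
  preserves_finite_limits (compF G F).
Proof.
intros HG HF J HJ K x l Hl.
exact (HG J HJ (compF F K) _ _ (HF J HJ K x l Hl)).
Qed.

Lemma adj_transposeK (C D : Category) (L : Functor C D) (R : Functor D C)
    (A : Adjunction L R) (x : C) (y : D) (a : Hom x (R y)) :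
  fmap R (adj_counit A y ∘ fmap L a) ∘ adj_unit A x = a.
Proof.
transitivity (fmap R (adj_counit A y) ∘ (adj_unit A (R y) ∘ a)).
- rewrite fmap_comp, <- comp_assoc; f_equal.
  symmetry; exact (naturality (adj_unit A) a).
- rewrite comp_assoc; transitivity (idm (R y) ∘ a);
    [f_equal; apply adj_triangle_r | apply comp_idl].
Qed.

Lemma right_adjoint_preserves (C D : Category) (L : Functor C D)
    (R : Functor D C) :
  Adjunction L R -> preserves_finite_limits R.
Proof.
intros A J _ K x l [Hc Hu]; split.
- intros i j u; transitivity (fmap R (fmap K u ∘ l i));
    [rewrite fmap_comp; reflexivity | f_equal; apply Hc].
- intros w c Hcone; simpl in c.
  destruct (Hu (L w) (fun j => adj_counit A (K j) ∘ fmap L (c j)))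
    as [h [Hh Hhu]].
  { intros i j u; rewrite <- (Hcone i j u); simpl.
    rewrite fmap_comp, !comp_assoc; f_equal.
    symmetry; exact (naturality (adj_counit A) (fmap K u)). }
  exists (fmap R h ∘ adj_unit A w); split.
  + intros j; rewrite comp_assoc.
    transitivity (fmap R (l j ∘ h) ∘ adj_unit A w);
      [rewrite fmap_comp; reflexivity | rewrite Hh; exact (adj_transposeK A (c j))].
  + intros k Hk.
    assert (E : h = adj_counit A x ∘ fmap L k).
    { apply Hhu; intros j; rewrite <- (Hk j), fmap_comp, !comp_assoc; f_equal.
      symmetry; exact (naturality (adj_counit A) (l j)). }
    rewrite E; exact (adj_transposeK A k).
Qed.

Definition idLex (C : Category) : LexFunctor C C :=
  {| lex_fun := idF C; lex_preserves := @idF_preserves C |}.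

Definition compLex (C D E : Category) (G : LexFunctor D E)
    (F : LexFunctor C D) : LexFunctor C E :=
  {| lex_fun := compF G F;
     lex_preserves := compF_preserves (lex_preserves G) (lex_preserves F) |}.

Record GeometricMorphism (E' E : Topos) : Type := {
  inverse_image : LexFunctor E E';
  direct_image_functor : Functor E' E;
  geom_adj : Adjunction inverse_image direct_image_functor
}.

Definition direct_image (E' E : Topos) (f : GeometricMorphism E' E) :
  LexFunctor E' E :=
  {| lex_fun := direct_image_functor f;
     lex_preserves := right_adjoint_preserves (geom_adj f) |}.

Definition geom_unit (E' E : Topos) (f : GeometricMorphism E' E) :
  NatTrans (idLex E) (compLex (direct_image f) (inverse_image f)) :=
  adj_unit (geom_adj f).

Definition pointwise_mono (C D : Category) (F G : Functor C D)
    (alpha : NatTrans F G) : Prop :=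
  forall x : C, mono (alpha x).

Definition elementary (C D : FinLimCat) (F G : LexFunctor C D)
    (alpha : NatTrans F G) : Prop :=
  forall (x y : C) (m : Hom x y), mono m ->
    is_pullback (fmap F m) (alpha x) (alpha y) (fmap G m).

Arguments elementary {C D F G} alpha.

(* Main.v *)
Require Import Defs.
From Stdlib Require Import List.

(** In a topos every monomorphism [m : x -> y] is the equalizer of its
    characteristic map and of the constant map true on [y]
    ([topos_mono_is_equalizer]).  This turns a naturality square at [m] into a
    naturality square at an equalizer, and those are pullbacks as soon as
    [alpha : F => G] is pointwise mono and [F], [G] preserve equalizers: if
    [m] equalizes [u] and [v], and [a] into [F y] becomes equal to some
    [G m ∘ b] after composition with [alpha y], then [alpha z] cannot
    distinguish [F u ∘ a] from [F v ∘ a], so these agree because [alpha z] is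
    mono, and [a] factors through the equalizer [F m]
    ([equalizer_square_pullback]).
    The unit of a geometric morphism is a transformation of this kind, since
    both the identity and [f_* f^*] preserve finite limits. *)

Definition is_equalizer (C : Category) (x y z : C) (m : Hom x y)
    (u v : Hom y z) : Prop :=
  u ∘ m = v ∘ m /\
  forall (w : C) (a : Hom w y), u ∘ a = v ∘ a ->
    exists! h : Hom w x, m ∘ h = a.

Arguments is_equalizer {C x y z} m u v.

Lemma equalizer_mono (C : Category) (x y z : C) (m : Hom x y)
    (u v : Hom y z) : is_equalizer m u v -> mono m.
Proof.
intros [Huv Hm] w a b Hab.
destruct (Hm w (m ∘ a)) as [h [_ Hh]].
{ rewrite !comp_assoc, Huv; reflexivity. }
rewrite <- (Hh a eq_refl); apply Hh; symmetry; exact Hab.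
Qed.

(** The pullback of [true : one -> omega] along the characteristic map [chi]
    of [m] is the equalizer of [chi] and [true ∘ !], because any two maps into
    [one] agree. *)
Lemma topos_mono_is_equalizer (E : Topos) (x y : E) (m : Hom x y) :
  mono m -> exists (z : E) (u v : Hom y z), is_equalizer m u v.
Proof.
intros Hm.
destruct (topos_classifier E) as [one [omega [tt [Hone Hcl]]]].
destruct (Hcl x y m Hm) as [chi [[t [Hsq Hpb]] _]].
destruct (Hone y) as [bang _].
assert (one_eq : forall (w : E) (s r : Hom w one), s = r).
{ intros w s r; destruct (Hone w) as [q [_ Hq]].
  rewrite <- (Hq s I); exact (Hq r I). }
exists omega, chi, (tt ∘ bang); split.
- rewrite Hsq, <- comp_assoc; f_equal; apply one_eq.
- intros w a Ha; rewrite <- comp_assoc in Ha.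
  destruct (Hpb w a (bang ∘ a) Ha) as [h [[Hh _] Hu]].
  exists h; split; [exact Hh |].
  intros k Hk; apply Hu; split; [exact Hk | apply one_eq].
Qed.

(** The source of the pair is [false], its target [true]; the two parallel
    arrows are the two booleans. *)
Definition parallel_hom (i j : bool) : Type :=
  match i, j with
  | false, true => bool
  | true, false => Empty_set
  | _, _ => unit
  end.

Definition parallel_id (i : bool) : parallel_hom i i :=
  match i with true => tt | false => tt end.

Definition parallel_comp (i j k : bool) :
  parallel_hom j k -> parallel_hom i j -> parallel_hom i k :=
  match i, j, k with
  | false, false, false => fun _ _ => tt
  | false, false, true => fun g _ => g
  | false, true, false => fun g _ => match g with end
  | false, true, true => fun _ f => f
  | true, false, _ => fun _ f => match f with end
  | true, true, false => fun g _ => g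
  | true, true, true => fun _ _ => tt
  end.

Definition parallel_pair : Category.
Proof.
refine {| Ob := bool; Hom := parallel_hom; idm := parallel_id;
          comp := parallel_comp |}.
- intros [] [] []; reflexivity.
- intros [] [] []; reflexivity.
- intros [] [] [] [] [] [] []; reflexivity.
Defined.

Lemma parallel_pair_finite : finite_category parallel_pair.
Proof.
split.
- exists (true :: false :: nil); intros []; simpl; auto.
- intros [] []; simpl.
  + exists (tt :: nil); intros []; simpl; auto.
  + exists nil; intros [].
  + exists (true :: false :: nil); intros []; simpl; auto.
  + exists (tt :: nil); intros []; simpl; auto.
Qed.

Section ParallelDiagram.
Variables (C : Category) (y z : C) (u v : Hom y z).

Definition parallel_obj (i : bool) : C := if i then z else y.

Definition parallel_map (i j : bool) :
  parallel_hom i j -> Hom (parallel_obj i) (parallel_obj j) :=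
  match i, j with
  | false, true => fun b : bool => if b then u else v
  | true, false => fun e => match e with end
  | false, false => fun _ => idm y
  | true, true => fun _ => idm z
  end.

Definition parallel_diagram : Functor parallel_pair C.
Proof.
refine (@Build_Functor parallel_pair C parallel_obj parallel_map _ _).
- intros []; reflexivity.
- intros [] [] [] [] []; simpl; rewrite ?comp_idl, ?comp_idr; reflexivity.
Defined.

Definition fork (x : C) (m : Hom x y) (j : bool) : Hom x (parallel_obj j) :=
  match j with true => u ∘ m | false => m end.

End ParallelDiagram.

(** Preservation of finite limits speaks of cones over diagrams; this puts an
    equalizer into that form, the leg at the target of the pair being the
    common composite. *)
Lemma equalizer_limit (C : Category) (x y z : C) (m : Hom x y)
    (u v : Hom y z) :
  is_equalizer m u v ->
  is_limit (parallel_diagram C y z u v) (fork C y z u x m).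
Proof.
intros [Huv Hm]; split.
- intros [] [] []; simpl; rewrite ?comp_idl; auto.
- intros w c Hc.
  pose proof (Hc false true true) as Hu; pose proof (Hc false true false) as Hv.
  simpl in Hu, Hv.
  destruct (Hm w (c false)) as [h [Hh Hhu]].
  { transitivity (c true); [exact Hu | symmetry; exact Hv]. }
  exists h; split.
  + intros []; simpl; [rewrite <- comp_assoc, Hh; exact Hu | exact Hh].
  + intros k Hk; apply Hhu; exact (Hk false).
Qed.

Lemma lex_equalizer (C D : Category) (F : LexFunctor C D) (x y z : C)
    (m : Hom x y) (u v : Hom y z) :
  is_equalizer m u v -> is_equalizer (fmap F m) (fmap F u) (fmap F v).
Proof.
intros Hm.
destruct (lex_preserves F parallel_pair_finite
            (equalizer_limit C x y z m u v Hm)) as [_ Hlim].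
split.
- rewrite <- !fmap_comp; f_equal; exact (proj1 Hm).
- intros w a Ha.
  destruct (Hlim w (fun j => match j with
      true => fmap F u ∘ a | false => a end)) as [h [Hh Hhu]].
  { intros [] [] []; simpl; rewrite ?fmap_id, ?comp_idl; auto. }
  exists h; split; [exact (Hh false) |].
  intros k Hk; apply Hhu; intros []; simpl; [| exact Hk].
  rewrite fmap_comp, <- comp_assoc, Hk; reflexivity.
Qed.

(** The mono [alpha z] yields the factorization [a = F m ∘ h]; that
    [alpha x ∘ h] is then the other given leg [b] is tested after composition
    with [G m], which is mono because it is again an equalizer. *)
Lemma equalizer_square_pullback (C D : Category) (F G : LexFunctor C D)
    (alpha : NatTrans F G) (x y z : C) (m : Hom x y) (u v : Hom y z) :
  pointwise_mono alpha -> is_equalizer m u v ->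
  is_pullback (fmap F m) (alpha x) (alpha y) (fmap G m).
Proof.
intros Halpha Hm.
destruct (lex_equalizer C D F x y z m u v Hm) as [_ HF].
pose proof (lex_equalizer C D G x y z m u v Hm) as HG.
split; [apply naturality |].
intros w a b Hab.
destruct (HF w a) as [h [Hh Hhu]].
(* Both sides become [G u ∘ G m ∘ b] after composition with [alpha z]. *)
{ apply (Halpha z).
  rewrite !comp_assoc, !naturality, <- !comp_assoc, Hab, !comp_assoc.
  f_equal; exact (proj1 HG). }
exists h; split; [split; [exact Hh |] | intros k [Hk _]; apply Hhu; exact Hk].
apply (equalizer_mono _ _ _ _ _ _ _ HG).
rewrite <- Hab, <- Hh, !comp_assoc, naturality; reflexivity.
Qed.

Lemma elementary_of_mono (E : Topos) (D : FinLimCat) (F G : LexFunctor E D)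
    (alpha : NatTrans F G) : pointwise_mono alpha -> elementary alpha.
Proof.
intros Halpha x y m Hm.
destruct (topos_mono_is_equalizer E x y m Hm) as [z [u [v Heq]]].
exact (equalizer_square_pullback E D F G alpha x y z m u v Halpha Heq).
Qed.

Theorem corollary5p13 (E' E : Topos) (f : GeometricMorphism E' E) :
  pointwise_mono (geom_unit f) -> elementary (geom_unit f).
Proof. apply elementary_of_mono. Qed.
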